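(* Consider the SLC problem where the number of machines $m\ge 2$ and the number of linear constraints $k\ge 2$ are fixed constants. The following enumeration algorithm returns an optimal solution and runs in $O(n^{m+k-1}L)$ time: for each subset $J'$ of the job set $J$ with $m+k-1$ jobs, and for each assignment of the jobs of $J'$ to the $m$ machines (letting $I_l$ denote the jobs of $J'$ assigned to machine $l$), solve the linear program $\min t$ subject to $A\bm{x}\ge\bm{b}$, $\sum_{i\in I_l}x_i\le t$ for $l=1,\ldots,m$, $x_i=0$ for $i\notin J'$, $\bm{x},t\ge 0$; if it is feasible, record the schedule (that assignment, with processing times given by the optimal $\bm{x}$) and its makespan. Finally return the recorded schedule with smallest makespan together with its processing times.
   Context: The SLC problem: there are $m$ identical parallel machines and a set $J$ of $n$ jobs. The processing times $\bm{x}=(x_1,\ldots,x_n)$ are decision variables and must satisfy $A\bm{x}\ge\bm{b}$, $\bm{x}\ge 0$, with $A\in\mathbb{R}^{k\times n}$, $\bm{b}\in\mathbb{R}^k$ given. The goal is to choose feasible processing times and an assignment of each job to exactly one machine so as to minimize the makespan, i.e. the maximum over machines of the total processing time of the jobs assigned to that machine. $L$ denotes the bit length of the input.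
   Formalization: When there are fewer than m+k−1 jobs no subset J' of that size exists and the algorithm as written would return nothing; here J' is then taken to be all of J. Infeasible instances are reported as such; time counts arithmetic and loop steps, for rational data and n ≥ 1. *)

(* Defs.v *)
From mathcomp Require Import all_boot all_order all_algebra.

Set Implicit Arguments.
Unset Strict Implicit.
Unset Printing Implicit Defensive.

Import Order.TTheory GRing.Theory Num.Theory.
Local Open Scope ring_scope.

(* A computation is a pair (number of elementary steps, result).  Arithmetic
   operations and comparisons on numbers are elementary steps, as is usual for
   running times of linear programming algorithms. *)
Definition cost (T : Type) : Type := (nat * T)%type.

Definition ret (T : Type) (x : T) : cost T := (0%N, x).

Definition bind (T U : Type) (c : cost T) (f : T -> cost U) : cost U :=
  ((c.1 + (f c.2).1)%N, (f c.2).2).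

Definition tick (T : Type) (a : nat) (c : cost T) : cost T :=
  ((a + c.1)%N, c.2).

Notation "x <-- c ;; f" := (bind c (fun x => f))
  (at level 100, c at next level, f at level 200, right associativity).

Definition steps (T : Type) (c : cost T) : nat := c.1.
Definition result (T : Type) (c : cost T) : T := c.2.

Definition nat_bits (a : nat) : nat := (trunc_log 2 a).+1.

(* One bit for the sign. *)
Definition rat_bits (x : rat) : nat :=
  (nat_bits `|numq x| + nat_bits `|denq x|).+1.

Definition mx_bits (r p : nat) (M : 'M[rat]_(r, p)) : nat :=
  (\sum_i \sum_j rat_bits (M i j))%N.

(* The program min c^T y subject to M y >= d, y >= 0. *)
Record lp (R : Type) (r p : nat) := LP {
  lp_mx : 'M[R]_(r, p);
  lp_rhs : 'cV[R]_r;
  lp_obj : 'cV[R]_p }.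

Definition lp_bits (r p : nat) (P : lp rat r p) : nat :=
  (nat_bits r + nat_bits p
   + mx_bits (lp_mx P) + mx_bits (lp_rhs P) + mx_bits (lp_obj P))%N.

Section LinearPrograms.
Variable R : realFieldType.

Definition lp_of_rat (r p : nat) (P : lp rat r p) : lp R r p :=
  LP (map_mx ratr (lp_mx P)) (map_mx ratr (lp_rhs P)) (map_mx ratr (lp_obj P)).

Section OneProgram.
Variables (r p : nat) (P : lp R r p).

Definition lp_feasible (y : 'cV[R]_p) : Prop :=
  (forall i, lp_rhs P i 0 <= (lp_mx P *m y) i 0) /\ (forall j, 0 <= y j 0).

Definition lp_value (y : 'cV[R]_p) : R := \sum_j lp_obj P j 0 * y j 0.

Definition lp_optimal (y : 'cV[R]_p) : Prop :=
  lp_feasible y /\ forall z, lp_feasible z -> lp_value y <= lp_value z.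

Definition lp_bounded : Prop :=
  exists v : R, forall y, lp_feasible y -> v <= lp_value y.

End OneProgram.

Definition lp_solver : Type :=
  forall r p : nat, lp R r p -> cost (option 'cV[R]_p).

(* [None] reports infeasibility; nothing is required on unbounded programs. *)
Definition lp_solver_correct (S : lp_solver) : Prop :=
  forall (r p : nat) (P : lp R r p), lp_bounded P ->
    match result (S r p P) with
    | Some y => lp_optimal P y
    | None => forall y, ~ lp_feasible P y
    end.

(* For each fixed number of constraints and variables, rational programs of
   bit length L are solved in O(L) steps. *)
Definition lp_solver_linear_time (S : lp_solver) : Prop :=
  forall r p : nat, exists c : nat, forall P : lp rat r p,
    (steps (S r p (lp_of_rat P)) <= c * lp_bits P)%N.

End LinearPrograms.

(* Arithmetic decision trees, a machine model for linear programming with fixed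
   dimensions.  They are pure syntax over the input data, so that every
   operation is charged for and a tree does not depend on the field.  The depth
   of a tree is a constant, hence on rational data of bit length L all
   intermediate numbers have O(L) bits. *)
Inductive lp_expr (r p : nat) : Type :=
| Coef of 'I_r & 'I_p
| Rhs of 'I_r
| Obj of 'I_p
| Cst of int
| Add of lp_expr r p & lp_expr r p
| Sub of lp_expr r p & lp_expr r p
| Mul of lp_expr r p & lp_expr r p
| Div of lp_expr r p & lp_expr r p.

Inductive lp_prog (r p : nat) : Type :=
| Return of option ('I_p -> lp_expr r p)
| IfLe of lp_expr r p & lp_expr r p & lp_prog r p & lp_prog r p.

Fixpoint eval_expr (R : realFieldType) (r p : nat) (P : lp R r p)
    (e : lp_expr r p) : cost R :=
  match e with
  | Coef i j => (1%N, lp_mx P i j)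
  | Rhs i => (1%N, lp_rhs P i 0)
  | Obj j => (1%N, lp_obj P j 0)
  | Cst z => (1%N, z%:~R)
  | Add e f => x <-- eval_expr P e ;; y <-- eval_expr P f ;; (1%N, x + y)
  | Sub e f => x <-- eval_expr P e ;; y <-- eval_expr P f ;; (1%N, x - y)
  | Mul e f => x <-- eval_expr P e ;; y <-- eval_expr P f ;; (1%N, x * y)
  | Div e f => x <-- eval_expr P e ;; y <-- eval_expr P f ;; (1%N, x / y)
  end.

Fixpoint run_prog (R : realFieldType) (r p : nat) (t : lp_prog r p)
    (P : lp R r p) : cost (option 'cV[R]_p) :=
  match t with
  | Return None => (1%N, None)
  | Return (Some out) =>
      ((\sum_j steps (eval_expr P (out j))).+1,
       Some (\col_j result (eval_expr P (out j))))
  | IfLe e f t1 t2 =>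
      x <-- eval_expr P e ;; y <-- eval_expr P f ;;
      tick 1 (if x <= y then run_prog t1 P else run_prog t2 P)
  end.

Definition prog_solver (T : forall r p : nat, lp_prog r p) (R : realFieldType) :
    lp_solver R :=
  fun r p P => run_prog (T r p) P.

Section SLC.
Variables (R : realFieldType) (m k n : nat).
Variables (A : 'M[R]_(k, n)) (b : 'cV[R]_k).

Definition slc_feasible (x : 'cV[R]_n) : Prop :=
  (forall i, b i 0 <= (A *m x) i 0) /\ (forall j, 0 <= x j 0).

Definition schedule : Type := ('cV[R]_n * {ffun 'I_n -> 'I_m})%type.

(* Processing times are nonnegative, so 0 is harmless as a default. *)
Definition makespan (s : schedule) : R :=
  \big[Num.max/0]_(l < m) \sum_(j | s.2 j == l) s.1 j 0.

Definition slc_optimal (s : schedule) : Prop :=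
  slc_feasible s.1 /\
  forall s' : schedule, slc_feasible s'.1 -> makespan s <= makespan s'.

(* A list of distinct (job, machine) pairs encodes a set J' of jobs together
   with its assignment to the machines: I_l is the set of jobs paired with l. *)
Definition passign : Type := seq ('I_n * 'I_m).

Definition job_of (s : passign) (j : 'I_(size s)) : 'I_n :=
  (tnth (in_tuple s) j).1.
Definition mach_of (s : passign) (j : 'I_(size s)) : 'I_m :=
  (tnth (in_tuple s) j).2.

(* min t  s.t.  A x >= b  and  t - \sum_(i in I_l) x_i >= 0 for each l, the
   variables x_i with i outside J' being fixed to 0, i.e. dropped; the last
   variable is t. *)
Definition slc_lp (s : passign) : lp R (k + m) (size s + 1) :=
  LP (block_mx (\matrix_(i < k, j < size s) A i (job_of j)) 0
               (\matrix_(l < m, j < size s) - (mach_of j == l)%:R) (const_mx 1))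
     (col_mx b 0)
     (col_mx 0 (const_mx 1)).

(* Calls [body] on each sublist of [s] of length [q], prepended to [J]. *)
Fixpoint for_subsets (St T : Type) (body : seq T -> St -> cost St)
    (q : nat) (s J : seq T) (st : St) {struct s} : cost St :=
  match q, s with
  | 0%N, _ => body J st
  | _.+1, [::] => tick 1 (ret st)
  | q'.+1, j :: s' =>
      tick 1 (st' <-- for_subsets body q' s' (j :: J) st ;;
              for_subsets body q s' J st')
  end.

Fixpoint for_each (St T : Type) (body : T -> St -> cost St)
    (s : seq T) (st : St) : cost St :=
  match s with
  | [::] => ret st
  | x :: s' => tick 1 (st' <-- body x st ;; for_each body s' st')
  end.

(* Calls [body] on each assignment of the jobs of [J], prepended to [s]. *)
Fixpoint for_assignments (St : Type) (body : passign -> St -> cost St)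
    (J : seq 'I_n) (s : passign) (st : St) : cost St :=
  match J with
  | [::] => body s st
  | j :: J' =>
      for_each (fun l => for_assignments body J' ((j, l) :: s)) (enum 'I_m) st
  end.

(* A recorded schedule: its makespan (the optimal t) and its jobs with their
   machines and processing times, all other jobs having processing time 0. *)
Definition record_entry : Type := (R * seq ('I_n * 'I_m * R))%type.

Definition entry_of (s : passign) (y : 'cV[R]_(size s + 1)) : record_entry :=
  (y (rshift (size s) 0) 0,
   [seq (job_of j, mach_of j, y (lshift 1 j) 0) | j <- enum 'I_(size s)]).

(* The first tick pays for writing down the linear program, the second one for
   the new entry and its comparison with the best one recorded so far. *)
Definition try_assignment (S : lp_solver R) (s : passign)
    (best : option record_entry) : cost (option record_entry) :=
  tick ((k + m) * (size s + 1) + (k + m) + (size s + 1))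
    (sol <-- S _ _ (slc_lp s) ;;
     match sol with
     | None => ret best
     | Some y =>
         let e := entry_of y in
         tick (size s).+2
           (ret (match best with
                 | Some e' => if e'.1 <= e.1 then best else Some e
                 | None => Some e
                 end))
     end).

(* [l0] is the machine that receives the jobs of processing time 0 outside J'. *)
Definition expand (l0 : 'I_m) (e : record_entry) : schedule :=
  (\col_j \sum_(u <- e.2 | u.1.1 == j) u.2,
   [ffun j => head l0 [seq u.1.2 | u <- e.2 & u.1.1 == j]]).

(* If there are fewer than m + k - 1 jobs, the only set considered is J. *)
Definition slc_enumeration (S : lp_solver R) (l0 : 'I_m) :
    cost (option schedule) :=
  best <-- for_subsets (fun J => for_assignments (try_assignment S) J [::])
             (minn n (m + k - 1)) (enum 'I_n) [::] None ;;
  match best with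
  | None => ret None
  | Some e => tick (n + size e.2) (ret (Some (expand l0 e)))
  end.

End SLC.

Definition slc_bits (m k n : nat) (A : 'M[rat]_(k, n)) (b : 'cV[rat]_k) : nat :=
  (nat_bits m + nat_bits k + nat_bits n + mx_bits A + mx_bits b)%N.

(* Main.v *)
Require Import Defs.
From mathcomp Require Import all_boot all_order all_algebra.
From mathcomp Require Import perm zify ring lra.

(* At a vertex of {x, t | A x >= b, loads <= t, x, t >= 0}, for the assignment
   of an arbitrary feasible schedule to all n jobs, at most k + m variables are
   nonzero: the columns of the k + m constraints that they index are independent.
   One of these variables is t (unless x = 0), so at most m + k - 1 jobs have a
   positive processing time, and the assignment restricted to these jobs, padded
   to a set of the required size, is one of those enumerated.

   A linear program that is bounded below attains its minimum at a vertex, which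
   Cramer's rule expresses through p of the r + p constraints.  Hence trying all
   choices of p constraints is a decision tree depending on r and p only. *)

Set Implicit Arguments.
Unset Strict Implicit.
Unset Printing Implicit Defensive.

Import Order.TTheory GRing.Theory Num.Theory.
Local Open Scope ring_scope.

(** * Vertices of a polyhedron [G y >= g], and descent to a vertex *)

Section Vertices.
Variables (R : realFieldType) (q p : nat).
Variables (G : 'M[R]_(q, p)) (g : 'cV[R]_q) (c : 'I_p -> R).
Implicit Types (y u : 'cV[R]_p).

Definition polyhedron y := forall i, g i 0 <= (G *m y) i 0.

Definition objective y := \sum_j c j * y j 0.

Definition tight y : {set 'I_q} := [set i | (G *m y) i 0 == g i 0].

(** Algebraic form: the tight rows have trivial kernel. Membership in the polyhedron is kept as a
    separate condition. *)
Definition vertex y :=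
  forall u, (forall i, i \in tight y -> (G *m u) i 0 = 0) -> u = 0.

Lemma objectiveD y u (s : R) : objective (y + s *: u) = objective y + s * objective u.
Proof.
rewrite /objective mulr_sumr -big_split; apply: eq_bigr => j _.
by rewrite !mxE mulrDr mulrCA.
Qed.

Lemma objectiveN u : objective (- u) = - objective u.
Proof. by rewrite /objective -sumrN; apply: eq_bigr => j _; rewrite !mxE mulrN. Qed.

Lemma row_full_or_ker a (K : 'M[R]_(a, p)) :
  row_full K \/ exists2 u : 'cV[R]_p, u != 0 & K *m u = 0.
Proof.
have [|rkK] := boolP (row_full K); [by left | right].
have : kermx K^T != 0 by rewrite kermx_eq0 /row_free mxrank_tr.
case/rowV0Pn => v /sub_kermxP vK vN0; exists v^T; first by rewrite trmx_eq0.
by apply: trmx_inj; rewrite trmx_mul trmxK vK trmx0.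
Qed.

Definition tight_rows y := rowsub (@enum_val _ (mem (tight y))) G.

Lemma tight_rows_ker (y u : 'cV[R]_p) :
  (forall i, i \in tight y -> (G *m u) i 0 = 0) <-> tight_rows y *m u = 0.
Proof.
rewrite /tight_rows mul_rowsub_mx; split=> [Gu | Ku i iT].
  by apply/colP => a; rewrite !mxE -[RHS](Gu _ (enum_valP a)) mxE.
move/colP/(_ (enum_rank_in iT i)): Ku; rewrite mxE enum_rankK_in // => ->.
by rewrite mxE.
Qed.

Lemma vertex_row_full y : vertex y -> row_full (tight_rows y).
Proof.
move=> vy; case: (row_full_or_ker (tight_rows y)) => // -[u uN0 Ku].
by rewrite (vy u) ?eqxx // in uN0; apply/tight_rows_ker.
Qed.

Lemma vertex_or_direction y : vertex y \/
  exists2 u : 'cV[R]_p, u != 0 & forall i, i \in tight y -> (G *m u) i 0 = 0.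
Proof.
have [full | [u uN0 Ku]] := row_full_or_ker (tight_rows y).
  left=> u /tight_rows_ker Ku; apply: trmx_inj; rewrite trmx0.
  apply: (row_free_inj (A := (tight_rows y)^T)).
    by rewrite /row_free mxrank_tr.
  by rewrite /= -trmx_mul Ku trmx0 mul0mx.
by right; exists u => //; apply/tight_rows_ker.
Qed.

(** The tight rows have rank [p], so [p] of them form an invertible system [B *m y = rowsub f g],
    solved by the adjugate. *)
Lemma vertex_cramer y : vertex y ->
  exists f : {ffun 'I_p -> 'I_q},
    let B := rowsub f G in
    \det B != 0 /\ y = (\det B)^-1 *: (\adj B *m rowsub f g).
Proof.
move/vertex_row_full => full.
exists [ffun a => enum_val (fullrankfun full a)] => B.
have BE : B = rowsub (fullrankfun full) (tight_rows y).
  by apply/matrixP => a j; rewrite !mxE ffunE.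
have Bu : \det B != 0 by rewrite -unitfE -[_ \in _]unitmxE BE fullrowsub_unit.
split=> //; have -> : rowsub [ffun a => enum_val (fullrankfun full a)] g = B *m y.
  rewrite mul_rowsub_mx; apply/colP => a; rewrite [LHS]mxE [RHS]mxE ffunE.
  by have := enum_valP (fullrankfun full a); rewrite inE => /eqP.
by rewrite mulmxA mul_adj_mx mul_scalar_mx scalerA mulVf ?scale1r.
Qed.

Hypothesis pointed : forall u, G *m u = 0 -> u = 0.
Variable v : R.
Hypothesis bounded : forall y, polyhedron y -> v <= objective y.

(* A descent direction lying in the polyhedron's recession cone would make the
   program unbounded; a neutral one is reversed, and the reverse direction
   leaves the cone because the polyhedron contains no line. *)
Lemma blocked_direction y u : polyhedron y -> u != 0 ->
  (forall i, i \in tight y -> (G *m u) i 0 = 0) ->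
  exists w, [/\ objective w <= 0, forall i, i \in tight y -> (G *m w) i 0 = 0
    & exists i, (G *m w) i 0 < 0].
Proof.
move=> Py.
wlog cu : u / objective u <= 0 => [th uN0 Tu | uN0 Tu].
  have [cu | /ltW cu] := leP (objective u) 0; first exact: th Tu.
  apply: (th (- u)); rewrite ?objectiveN ?oppr_le0 ?oppr_eq0 // => i iT.
  by rewrite mulmxN mxE Tu ?oppr0.
have [/existsP blk | /existsPn rec] := boolP [exists i, (G *m u) i 0 < 0].
  by exists u.
have Gu i : 0 <= (G *m u) i 0 by rewrite leNgt; apply: rec.
have cu0 : objective u = 0.
  apply/eqP; rewrite eq_le cu leNgt; apply/negP => cuN.
  (* This step length would bring the objective down to [v - 1], below its lower bound [v]. *)
  pose s := (objective y - v + 1) / (- objective u).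
  have s0 : 0 <= s.
    by apply: divr_ge0; [have := bounded Py; lra | rewrite oppr_ge0].
  have /bounded : polyhedron (y + s *: u).
    move=> i; rewrite mulmxDr -scalemxAr !mxE (le_trans (Py i)) // mxE lerDl.
    by rewrite mulr_ge0 //; have := Gu i; rewrite mxE.
  rewrite objectiveD /s invrN mulrN mulNr -mulrA mulVf ?lt_eqF //; lra.
exists (- u); rewrite objectiveN cu0 oppr0; split=> // [i iT|].
  by rewrite mulmxN mxE Tu ?oppr0.
case: (pickP [pred i | (G *m u) i 0 != 0]) => [i /= Gui | Gu0].
  by exists i; rewrite mulmxN mxE oppr_lt0 lt_neqAle eq_sym Gui Gu.
case/negP: uN0; apply/eqP/pointed/colP => i; rewrite [RHS]mxE.
exact/eqP/negbFE/(Gu0 i).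
Qed.

(** Induction on the number of slack constraints: a move along a blocked direction that does not
    increase the objective keeps the tight constraints tight and stops when a further one becomes
    tight. *)
Lemma improve_to_vertex y : polyhedron y ->
  exists z, [/\ polyhedron z, objective z <= objective y & vertex z].
Proof.
have [a] := ubnP #|~: tight y|; elim: a y => // a IH y card_y Py.
have [vy | [u uN0 Tu]] := vertex_or_direction y; first by exists y.
have [w [cw Tw [i0 Gi0]]] := blocked_direction Py uN0 Tu.
(* Ratio test: constraint [i], decreasing along [w], becomes tight after the step [ratio i]; the
   smallest such step violates no constraint. *)
pose ratio i := ((G *m y) i 0 - g i 0) / - (G *m w) i 0.
case: (arg_minP (P := fun i => (G *m w) i 0 < 0) ratio Gi0) => i Gi min_i.
set s := ratio i in min_i.
have s0 : 0 <= s by rewrite divr_ge0 ?subr_ge0 ?oppr_ge0 // ltW.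
have GzE l : (G *m (y + s *: w)) l 0 = (G *m y) l 0 + s * (G *m w) l 0.
  by rewrite mulmxDr -scalemxAr [LHS]mxE [X in _ + X = _]mxE.
have Pz : polyhedron (y + s *: w).
  move=> l; rewrite GzE; have [Gl | Gl] := ltP ((G *m w) l 0) 0.
    have := min_i l Gl; rewrite ler_pdivlMr ?oppr_gt0 //; lra.
  by apply: (le_trans (Py l)); rewrite lerDl mulr_ge0.
have cz : objective (y + s *: w) <= objective y.
  by rewrite objectiveD gerDl mulr_ge0_le0.
have [|z [Pz' cz' vz]] := IH (y + s *: w) _ Pz; last first.
  by exists z; split=> //; apply: le_trans cz' cz.
rewrite -ltnS (leq_trans _ card_y) // ltnS; apply: proper_card.
rewrite properE setCS; apply/andP; split.
  apply/subsetP => l lT; rewrite inE GzE Tw // mulr0 addr0.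
  by rewrite inE in lT.
apply/subsetPn; exists i.
  by rewrite !inE; apply: contraTN Gi => /eqP Ti; rewrite Tw ?ltxx // inE Ti.
rewrite !inE negbK GzE /s /ratio; apply/eqP; field.
by rewrite lt_eqF.
Qed.

End Vertices.

(** * Vertices of linear programs and their supports *)

Section LPVertices.
Variables (R : realFieldType) (r p : nat) (P : lp R r p).

(** Sign constraints count as rows too; the identity block then makes the kernel trivial, so the
    polyhedron contains no line. *)
Definition all_rows := col_mx (lp_mx P) 1%:M.
Definition all_rhs : 'cV[R]_(r + p) := col_mx (lp_rhs P) 0.

Lemma polyhedron_lpE y : polyhedron all_rows all_rhs y <-> lp_feasible P y.
Proof.
split=> [Py | [My y0] i].
  split=> [i | j].
    by have := Py (lshift p i); rewrite mul_col_mx !col_mxEu.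
  by have := Py (rshift r j); rewrite mul_col_mx !col_mxEd mul1mx mxE.
rewrite mul_col_mx -(splitK i); case: split => j /=.
  by rewrite !col_mxEu.
by rewrite !col_mxEd mul1mx mxE.
Qed.

Lemma lp_vertex y : lp_bounded P -> lp_feasible P y ->
  exists z, [/\ lp_feasible P z, lp_value P z <= lp_value P y
    & vertex all_rows all_rhs z].
Proof.
case=> v bnd /polyhedron_lpE Py.
have [||z [/polyhedron_lpE Pz cz vz]] :=
  improve_to_vertex (c := fun j => lp_obj P j 0) _ _ Py (v := v).
- by move=> u; rewrite mul_col_mx mul1mx -col_mx0 => /eq_col_mx[].
- by move=> z /polyhedron_lpE; apply: bnd.
by exists z.
Qed.

(* At a vertex, the columns of the constraint matrix indexed by the positive
   variables are linearly independent. *)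
Lemma vertex_support z : vertex all_rows all_rhs z ->
  (#|[set j | z j 0 != 0]%R| <= r)%N.
Proof.
move=> vz; set S := [set _ | _].
(* [E] extends a vector indexed by [S] by zeros to all [p] coordinates. *)
pose E : 'M[R]_(p, #|S|) := colsub (@enum_val _ (mem S)) 1%:M.
have EE (u : 'cV[R]_#|S|) j : j \notin S -> (E *m u) j 0 = 0.
  move=> jS; rewrite mxE big1 // => a _; rewrite !mxE.
  by case: eqP => [ja | _]; rewrite ?mul0r //; move: (enum_valP a) jS; rewrite -ja => ->.
have Einj (u : 'cV[R]_#|S|) : E *m u = 0 -> u = 0.
  move=> /colP Eu; apply/colP => a; move: (Eu (enum_val a)).
  rewrite !mxE (bigD1 a) //= big1 ?addr0 ?mxE ?eqxx ?mul1r // => b ba.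
  rewrite !mxE; case: eqP => [/enum_val_inj ab|]; rewrite ?mul0r //.
  by rewrite ab eqxx in ba.
(* Independent columns number at most [r]. Otherwise a dependency [u] gives a nonzero direction
   [E *m u] on which the rows of [lp_mx P] vanish, as do the tight sign constraints, whose indices
   lie outside [S]; a vertex has no such direction. *)
have [|[u uN0 MEu]] := row_full_or_ker (lp_mx P *m E).
  by move/eqP=> rk; have := rank_leq_row (lp_mx P *m E); rewrite rk.
case/negP: uN0; apply/eqP/Einj/vz => i.
rewrite inE /all_rows /all_rhs !mul_col_mx -(splitK i); case: split => j /=.
  by move=> _; rewrite col_mxEu mulmxA MEu mxE.
rewrite !col_mxEd !mul1mx [X in _ == X]mxE => /eqP zj.
by apply: EE; rewrite inE zj eqxx.
Qed.

End LPVertices.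

(** * Running time of decision trees *)

Section ProgramSteps.
Variables (r p : nat).

Fixpoint expr_steps (e : lp_expr r p) : nat :=
  match e with
  | Add e f | Defs.Sub e f | Mul e f | Div e f => (expr_steps e + (expr_steps f + 1))%N
  | _ => 1%N
  end.

(** The costlier branch is charged at each test, which makes the bound independent of the data. *)
Fixpoint prog_steps (t : lp_prog r p) : nat :=
  match t with
  | Return None => 1%N
  | Return (Some out) => (\sum_j expr_steps (out j)).+1
  | IfLe e f t1 t2 =>
      (expr_steps e + (expr_steps f + (1 + maxn (prog_steps t1) (prog_steps t2))))%N
  end.

Lemma steps_eval (R : realFieldType) (P : lp R r p) e :
  steps (eval_expr P e) = expr_steps e.
Proof. by rewrite /steps; elim: e => //= e -> f ->. Qed.

Lemma steps_run (R : realFieldType) (P : lp R r p) t :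
  (steps (run_prog t P) <= prog_steps t)%N.
Proof.
elim: t => [[out|] | e f t1 IH1 t2 IH2] //=.
  by rewrite /steps /= ltnS; apply: leq_sum => j _; rewrite -(steps_eval P).
rewrite -!(steps_eval P) /steps /= !leq_add2l leq_max.
by case: ifP => _; [rewrite [X in X || _]IH1 | rewrite [X in _ || X]IH2 orbT].
Qed.

End ProgramSteps.

(** * A decision tree solving linear programs of fixed dimensions *)

Section Programs.
Variables (r p : nat).
Implicit Types (out : 'I_p -> lp_expr r p).

Definition expr_sum I (s : seq I) (F : I -> lp_expr r p) :=
  foldr (fun i e => Add (F i) e) (Cst r p 0) s.

Definition expr_prod I (s : seq I) (F : I -> lp_expr r p) :=
  foldr (fun i e => Mul (F i) e) (Cst r p 1) s.

(** Leibniz formula. *)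
Definition expr_det q (B : 'I_q -> 'I_q -> lp_expr r p) :=
  expr_sum (enum {perm 'I_q}) (fun s =>
    Mul (Cst r p ((-1) ^+ s)) (expr_prod (enum 'I_q) (fun i => B i (s i)))).

Definition row_expr (i : 'I_(r + p)) (j : 'I_p) :=
  match split i with
  | inl a => Coef a j
  | inr b => Cst r p (b == j)
  end.

Definition rhs_expr (i : 'I_(r + p)) :=
  match split i with
  | inl a => Rhs p a
  | inr _ => Cst r p 0
  end.

(** Cramer's rule with the adjugate expanded into cofactors. For a singular choice of rows, division
    by 0 yields the zero point; this is harmless because every candidate is tested for
    feasibility. *)
Definition basic_point (f : {ffun 'I_p -> 'I_(r + p)}) (j : 'I_p) :=
  Div (expr_sum (enum 'I_p) (fun i =>
         Mul (Mul (Cst r p ((-1) ^+ (i + j)))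
                  (expr_det (fun a b => row_expr (f (lift i a)) (lift j b))))
             (rhs_expr (f i))))
      (expr_det (fun a b => row_expr (f a) b)).

Definition value_expr out :=
  expr_sum (enum 'I_p) (fun j => Mul (Obj r j) (out j)).

Definition feasibility_tests out : seq (lp_expr r p * lp_expr r p) :=
  [seq (Rhs p i, expr_sum (enum 'I_p) (fun j => Mul (Coef i j) (out j)))
     | i <- enum 'I_r]
  ++ [seq (Cst r p 0, out j) | j <- enum 'I_p].

Definition if_all (tests : seq (lp_expr r p * lp_expr r p)) t1 t2 :=
  foldr (fun c t => IfLe c.1 c.2 t t2) t1 tests.

(** The best candidate is carried as a choice of rows, known when the tree is built and determined
    by the path; its coordinates and value are recomputed at each use. *)
Fixpoint best_point (fs : seq {ffun 'I_p -> 'I_(r + p)})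
    (best : option {ffun 'I_p -> 'I_(r + p)}) : lp_prog r p :=
  match fs with
  | [::] => Return (omap basic_point best)
  | f :: fs' =>
      if_all (feasibility_tests (basic_point f))
        match best with
        | None => best_point fs' (Some f)
        | Some f' =>
            IfLe (value_expr (basic_point f')) (value_expr (basic_point f))
              (best_point fs' best) (best_point fs' (Some f))
        end
        (best_point fs' best)
  end.

Definition vertex_prog := best_point (enum {ffun 'I_p -> 'I_(r + p)}) None.

Variables (R : realFieldType) (P : lp R r p).
Let ev (e : lp_expr r p) := result (eval_expr P e).
Definition eval_point out : 'cV[R]_p := \col_j ev (out j).

Lemma ev_cst z : ev (Cst r p z) = z%:~R. Proof. by []. Qed.

Lemma ev_mul e1 e2 : ev (Mul e1 e2) = ev e1 * ev e2. Proof. by []. Qed.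

Lemma ev_div e1 e2 : ev (Div e1 e2) = ev e1 / ev e2. Proof. by []. Qed.

Lemma ev_sum I (s : seq I) F : ev (expr_sum s F) = \sum_(i <- s) ev (F i).
Proof.
rewrite /expr_sum; elim: s => [|i s IH] /=; first by rewrite big_nil ev_cst.
by rewrite big_cons -IH.
Qed.

Lemma ev_prod I (s : seq I) F : ev (expr_prod s F) = \prod_(i <- s) ev (F i).
Proof.
rewrite /expr_prod; elim: s => [|i s IH] /=; first by rewrite big_nil ev_cst.
by rewrite big_cons -IH.
Qed.

Lemma ev_det q (B : 'I_q -> 'I_q -> lp_expr r p) :
  ev (expr_det B) = \det (\matrix_(i, j) ev (B i j)).
Proof.
rewrite /expr_det ev_sum big_enum; apply: eq_bigr => s _.
rewrite ev_mul ev_cst ev_prod big_enum rmorph_sign.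
by congr (_ * _); apply: eq_bigr => i _; rewrite mxE.
Qed.

Lemma ev_row i j : ev (row_expr i j) = all_rows P i j.
Proof.
rewrite /row_expr /all_rows -{2}(splitK i); case: split => a /=.
  by rewrite col_mxEu.
by rewrite col_mxEd mxE /ev /=; case: eqP.
Qed.

Lemma ev_rhs i : ev (rhs_expr i) = all_rhs P i 0.
Proof.
rewrite /rhs_expr /all_rhs -{2}(splitK i); case: split => a /=.
  by rewrite col_mxEu.
by rewrite col_mxEd mxE.
Qed.

Lemma eval_basic_point (f : {ffun 'I_p -> 'I_(r + p)}) :
  let B := rowsub f (all_rows P) in
  eval_point (basic_point f) = (\det B)^-1 *: (\adj B *m rowsub f (all_rhs P)).
Proof.
move=> B; apply/colP => j; rewrite [LHS]mxE ev_div mulrC ev_det ev_sum big_enum.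
rewrite [RHS]mxE [X in _ = _ * X]mxE; congr (_^-1 * _).
  by congr (\det _); apply/matrixP => a b; rewrite mxE ev_row [RHS]mxE.
apply: eq_bigr => i _; rewrite !ev_mul ev_cst ev_det ev_rhs rmorph_sign [in RHS]mxE.
rewrite [X in _ = _ * X]mxE.
congr (_ * _ * _); congr (\det _); apply/matrixP => a b.
by rewrite mxE ev_row 2![RHS]mxE [RHS]mxE.
Qed.

Lemma ev_value out : ev (value_expr out) = lp_value P (eval_point out).
Proof. by rewrite /value_expr ev_sum big_enum; apply: eq_bigr => j _; rewrite mxE. Qed.

Lemma run_if_all tests t1 t2 :
  result (run_prog (if_all tests t1 t2) P) =
  if all (fun c => ev c.1 <= ev c.2) tests
  then result (run_prog t1 P) else result (run_prog t2 P).
Proof.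
rewrite /if_all; elim: tests => //= c tests IH.
rewrite {1}/result /= -/(ev c.1) -/(ev c.2).
by case: (ev c.1 <= ev c.2).
Qed.

Lemma feasibility_testsP out :
  reflect (lp_feasible P (eval_point out))
          (all (fun c => ev c.1 <= ev c.2) (feasibility_tests out)).
Proof.
have evM i : ev (expr_sum (enum 'I_p) (fun j => Mul (Coef i j) (out j))) =
    (lp_mx P *m eval_point out) i 0.
  by rewrite ev_sum big_enum mxE; apply: eq_bigr => j _; rewrite mxE.
rewrite all_cat [X in X && _]all_map [X in _ && X]all_map.
apply: (iffP andP) => [[/allP Mo /allP o0] | [Mo o0]].
  split=> [i | j]; first by rewrite -evM; apply: (Mo i); rewrite mem_enum.
  by rewrite mxE; apply: (o0 j); rewrite mem_enum.
split; apply/allP => j _ /=; first by rewrite evM; apply: Mo.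
by have := o0 j; rewrite mxE.
Qed.

Lemma run_if_le e1 e2 t1 t2 :
  result (run_prog (IfLe e1 e2 t1 t2) P) =
  if ev e1 <= ev e2 then result (run_prog t1 P) else result (run_prog t2 P).
Proof. by rewrite {1}/result /= -/(ev e1) -/(ev e2); case: ifP. Qed.

Let point f := eval_point (basic_point f).

(** Invariant of the search, by induction on the remaining candidates: whichever candidate is
    carried on is feasible and no worse than those already compared. *)
Lemma best_point_spec fs best :
  (if best is Some f then lp_feasible P (point f) else True) ->
  match result (run_prog (best_point fs best) P) with
  | Some y => [/\ lp_feasible P y,
      forall f, f \in fs -> lp_feasible P (point f) ->
        lp_value P y <= lp_value P (point f) &
      if best is Some f then lp_value P y <= lp_value P (point f) else True]
  | None => best = None /\ forall f, f \in fs -> ~ lp_feasible P (point f)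
  end.
Proof.
elim: fs best => [|f fs IH] best best_f /=; first by case: best best_f.
rewrite run_if_all; case: feasibility_testsP => [ff | nff]; last first.
  have := IH best best_f; case: (result _) => [y [fy le_y y_best] | [-> nfs]].
    by split=> // f'; rewrite inE => /orP[/eqP-> // | /le_y].
  by split=> // f'; rewrite inE => /orP[/eqP-> | /nfs].
case: best best_f => [f0|] ff0; last first.
  have := IH (Some f) ff; case: (result _) => [y [fy le_y y_f] | [] //].
  by split=> // f'; rewrite inE => /orP[/eqP-> | /le_y].
rewrite run_if_le !ev_value; case: leP => [le_f0 | /ltW lt_f].
  have := IH (Some f0) ff0; case: (result _) => [y [fy le_y y_f0] | [] //].
  split=> // f'; rewrite inE => /orP[/eqP-> _ | /le_y //].
  exact: le_trans le_f0.
have := IH (Some f) ff; case: (result _) => [y [fy le_y y_f] | [] //].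
split=> //; last exact: le_trans lt_f.
by move=> f'; rewrite inE => /orP[/eqP-> | /le_y].
Qed.

(** Every feasible point is matched or beaten by a feasible vertex, which Cramer's rule places among
    the candidates. *)
Lemma vertex_prog_correct : lp_bounded P ->
  match result (run_prog vertex_prog P) with
  | Some y => lp_optimal P y
  | None => forall y, ~ lp_feasible P y
  end.
Proof.
move=> bnd; have cand y : lp_feasible P y ->
    exists2 f, lp_feasible P (point f) & lp_value P (point f) <= lp_value P y.
  case/(lp_vertex bnd) => z [fz le_z /vertex_cramer[f [_ zE]]].
  by exists f; rewrite /point eval_basic_point -zE.
have := @best_point_spec (enum {ffun 'I_p -> 'I_(r + p)}) None I.
rewrite -/vertex_prog; case: (result _) => [y [fy le_y _] | [_ nf] y].
  split=> // z /cand[f ff le_z]; apply: le_trans le_z; apply: le_y => //.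
  by rewrite mem_enum.
by case/cand => f ff _; apply: nf ff; rewrite mem_enum.
Qed.

End Programs.

(** For fixed dimensions the step count is bounded by a constant, and the bit length is at least
    1. *)
Lemma vertex_prog_linear_time (R : realFieldType) :
  lp_solver_linear_time (prog_solver vertex_prog (R := R)).
Proof.
move=> r p; exists (prog_steps (vertex_prog r p)) => P.
apply: leq_trans (steps_run _ _) _; apply: leq_pmulr.
by rewrite /lp_bits /nat_bits !addSn.
Qed.

(** * The enumeration loops as folds over explicit lists *)

Section Loops.

Fixpoint subsets_of (T : Type) (q : nat) (s J : seq T) : seq (seq T) :=
  match q, s with
  | 0%N, _ => [:: J]
  | _.+1, [::] => [::]
  | q'.+1, j :: s' => subsets_of q' s' (j :: J) ++ subsets_of q s' J
  end.

Fixpoint assignments_of (n m : nat) (J : seq 'I_n) (s : passign m n) :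
    seq (passign m n) :=
  match J with
  | [::] => [:: s]
  | j :: J' => flatten [seq assignments_of J' ((j, l) :: s) | l <- enum 'I_m]
  end.

Lemma result_for_each (St T : Type) (body : T -> St -> cost St) s st :
  result (for_each body s st) = foldl (fun st x => result (body x st)) st s.
Proof. by elim: s st => //= x s IH st; rewrite -IH. Qed.

Lemma result_for_subsets (St T : Type) (body : seq T -> St -> cost St) q s J st :
  result (for_subsets body q s J st) =
  foldl (fun st J' => result (body J' st)) st (subsets_of q s J).
Proof.
elim: s q J st => [|j s IH] [|q] J st //=.
by rewrite foldl_cat -!IH.
Qed.

Lemma foldl_flatten (A B : Type) (f : A -> B -> A) (ss : seq (seq B)) a :
  foldl f a (flatten ss) = foldl (foldl f) a ss.
Proof. by elim: ss a => //= s ss IH a; rewrite foldl_cat IH. Qed.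

Lemma foldl_map (A B C : Type) (f : A -> C -> A) (h : B -> C) (s : seq B) a :
  foldl f a (map h s) = foldl (fun a x => f a (h x)) a s.
Proof. by elim: s a => //= x s IH a. Qed.

Lemma eq_foldl (A B : Type) (f g : A -> B -> A) (s : seq B) a :
  f =2 g -> foldl f a s = foldl g a s.
Proof. by move=> fg; elim: s a => //= x s IH a; rewrite fg. Qed.

Lemma result_for_assignments (St : Type) (n m : nat)
    (body : passign m n -> St -> cost St) J s st :
  result (for_assignments body J s st) =
  foldl (fun st s' => result (body s' st)) st (assignments_of J s).
Proof.
elim: J s st => //= j J IH s st.
rewrite result_for_each foldl_flatten foldl_map.
by apply: eq_foldl => st' l; rewrite IH.
Qed.

(** Chosen elements are pushed onto the accumulator one by one, so a sublist [t] arrives reversed in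
    front of [J]. *)
Lemma mem_subsets_of (T : eqType) q (s J J' : seq T) :
  reflect (exists2 t, subseq t s & size t = q /\ J' = catrev t J)
          (J' \in subsets_of q s J).
Proof.
apply: (iffP idP) => [|[t st [tq ->]]].
  elim: s q J => [|j s IH] [|q] J //=.
  - by rewrite inE => /eqP ->; exists [::].
  - by rewrite inE => /eqP ->; exists [::].
  rewrite mem_cat => /orP[/IH[t ts [tq ->]] | /IH[t ts [tq ->]]].
    by exists (j :: t); rewrite /= ?eqxx ?tq.
  by exists t => //; apply: subseq_trans ts (subseq_cons _ _).
elim: s q t J st tq => [|j s IH] q t J.
  by rewrite subseq0 => /eqP -> /= <-; rewrite inE.
case: t => [|a t] /= st <- /=; first by rewrite inE.
rewrite mem_cat; case: eqP st => [-> ts | _ ats].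
  by rewrite (IH _ t (j :: J)).
by rewrite [X in _ || X](IH _ (a :: t) J) ?orbT.
Qed.

Lemma assignments_of_jobs n m (J : seq 'I_n) (s s' : passign m n) :
  s' \in assignments_of J s -> unzip1 s' = catrev J (unzip1 s).
Proof.
elim: J s => [|j J IH] s /=; first by rewrite inE => /eqP ->.
by case/flatten_mapP => l _ /IH.
Qed.

Lemma mem_assignments_of n m (a : 'I_n -> 'I_m) (J : seq 'I_n) s :
  catrev [seq (j, a j) | j <- J] s \in assignments_of J s.
Proof.
elim: J s => [|j J IH] s /=; first by rewrite inE.
by apply/flatten_mapP; exists (a j); rewrite ?mem_enum.
Qed.

End Loops.

(** * Correctness of the enumeration algorithm *)

Section Expansion.
Variables (R : realFieldType) (m k n : nat).
Variables (A : 'M[R]_(k, n)) (b : 'cV[R]_k) (l0 : 'I_m).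
Implicit Types (s : passign m n) (sigma : schedule R m n).

Lemma slc_lp_bounded s : lp_bounded (slc_lp A b s).
Proof.
exists 0 => y [_ y0]; apply: sumr_ge0 => j _; rewrite mulr_ge0 //.
rewrite /slc_lp /= -(splitK j); case: split => a /=.
  by rewrite col_mxEu mxE.
by rewrite col_mxEd mxE.
Qed.

Lemma slc_lp_value s y : lp_value (slc_lp A b s) y = y (rshift (size s) 0) 0.
Proof.
rewrite /lp_value big_split_ord /= big_ord1 col_mxEd mxE mul1r.
by rewrite big1 ?add0r // => i _; rewrite col_mxEu mxE mul0r.
Qed.

Lemma slc_lp_feasibleE s y : lp_feasible (slc_lp A b s) y <->
  [/\ forall i, b i 0 <= \sum_(j < size s) A i (job_of j) * y (lshift 1 j) 0,
      forall l, \sum_(j < size s | mach_of j == l) y (lshift 1 j) 0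
                  <= y (rshift (size s) 0) 0 &
      forall j, 0 <= y j 0].
Proof.
have conE i : (lp_mx (slc_lp A b s) *m y) (lshift m i) 0 =
    \sum_(j < size s) A i (job_of j) * y (lshift 1 j) 0.
  rewrite mxE big_split_ord /= big_ord1 block_mxEur mxE mul0r addr0.
  by apply: eq_bigr => j _; rewrite block_mxEul mxE.
have loadE l : (lp_mx (slc_lp A b s) *m y) (rshift k l) 0 =
    y (rshift (size s) 0) 0 - \sum_(j < size s | mach_of j == l) y (lshift 1 j) 0.
  rewrite mxE big_split_ord /= big_ord1 block_mxEdr mxE mul1r addrC.
  congr (_ + _); rewrite -sumrN [RHS]big_mkcond; apply: eq_bigr => j _.
  by rewrite block_mxEdl mxE; case: eqP; rewrite ?mulN1r // oppr0 mul0r.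
split=> [[fy y0] | [con load y0]].
  split=> // [i | l].
    by have := fy (lshift m i); rewrite conE /= col_mxEu.
  by have := fy (rshift k l); rewrite loadE /= col_mxEd mxE subr_ge0.
split=> // i; rewrite -(splitK i); case: split => a.
  by rewrite [unsplit _]/= conE /= col_mxEu.
by rewrite [unsplit _]/= loadE /= col_mxEd mxE subr_ge0.
Qed.

Lemma makespan_load sigma l : \sum_(j | sigma.2 j == l) sigma.1 j 0 <= makespan sigma.
Proof. exact: (le_bigmax 0 (fun l => \sum_(j | sigma.2 j == l) sigma.1 j 0)). Qed.

Lemma makespan_le sigma t : 0 <= t ->
  (forall l, \sum_(j | sigma.2 j == l) sigma.1 j 0 <= t) -> makespan sigma <= t.
Proof. by move=> t0 load; apply: bigmax_le. Qed.

Lemma makespan_ge0 sigma : 0 <= makespan sigma.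
Proof. exact: bigmax_ge_id. Qed.

Lemma expand_time s (y : 'cV[R]_(size s + 1)) j :
  (expand l0 (entry_of y)).1 j 0 = \sum_(i | job_of i == j) y (lshift 1 i) 0.
Proof. by rewrite mxE big_map big_enum_cond. Qed.

(** As jobs are distinct, position [i] is the only match for its job, and the default [l0] does not
    intervene. *)
Lemma expand_machine s (y : 'cV[R]_(size s + 1)) (i : 'I_(size s)) : uniq (unzip1 s) ->
  (expand l0 (entry_of y)).2 (job_of i) = mach_of i.
Proof.
move=> us; have job_inj : injective (@job_of m n s).
  move=> i1 i2 /eqP; rewrite /job_of !(tnth_nth (job_of i, mach_of i)) /=.
  rewrite -!(nth_map _ (job_of i) fst) ?size_map //.
  by rewrite nth_uniq ?size_map // => /eqP /val_inj.
rewrite ffunE filter_map -map_comp.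
set t := [seq _ <- _ | _]; have: all (pred1 i) t.
  by apply/allP => i'; rewrite mem_filter /= => /andP[/eqP/job_inj -> _].
have: i \in t by rewrite mem_filter /= eqxx mem_enum.
by case: t => //= i' t _ /andP[/eqP->].
Qed.

(** From program to schedule: jobs absent from [s] get time 0, so grouping positions by job
    preserves constraint sums and loads. *)
Lemma expand_feasible s (y : 'cV[R]_(size s + 1)) : uniq (unzip1 s) ->
  lp_feasible (slc_lp A b s) y ->
  slc_feasible A b (expand l0 (entry_of y)).1 /\
  makespan (expand l0 (entry_of y)) <= y (rshift (size s) 0) 0.
Proof.
move=> us /slc_lp_feasibleE[con load y0]; split.
  split=> [i | j]; last by rewrite expand_time sumr_ge0.
  apply: le_trans (con i) _; rewrite mxE.
  rewrite (partition_big (@job_of m n s) xpredT) //=; apply: ler_sum => j _.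
  rewrite expand_time mulr_sumr; apply: ler_sum => a.
  by move/eqP->.
apply: makespan_le => // l; apply: le_trans (load l).
rewrite [leRHS](partition_big (@job_of m n s)
  (fun j => (expand l0 (entry_of y)).2 j == l)) /= => [|i]; last first.
  by rewrite expand_machine.
apply: ler_sum => j jl; rewrite expand_time le_eqVlt; apply/orP; left.
apply/eqP/eq_bigl => i; case: eqP => [ij|]; rewrite ?andbF // andbT.
by rewrite -(expand_machine y) // ij jl.
Qed.

(** From schedule to program: jobs outside [J] have time 0, so dropping their variables changes no
    sum, and the makespan serves as [t]. *)
Lemma restrict_feasible sigma (J : seq 'I_n) :
  slc_feasible A b sigma.1 -> uniq J -> (forall j, sigma.1 j 0 != 0 -> j \in J) ->
  let s := [seq (j, sigma.2 j) | j <- J] : passign m n in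
  exists2 y, lp_feasible (slc_lp A b s) y & y (rshift (size s) 0) 0 = makespan sigma.
Proof.
move=> [con x0] uJ suppJ s.
have sumE (F : 'I_n -> 'I_m -> R) : (forall j l, sigma.1 j 0 = 0 -> F j l = 0) ->
    \sum_(i < size s) F (job_of i) (mach_of i) = \sum_j F j (sigma.2 j).
  move=> F0; rewrite -(big_tnth _ _ s xpredT (fun u => F u.1 u.2)) big_map.
  rewrite big_uniq // [RHS](bigID (mem J)) /= [X in _ + X]big1 ?addr0 // => j jJ.
  by apply: F0; apply/eqP; apply: contraNT jJ => /suppJ.
exists (col_mx (\col_i sigma.1 (job_of i) 0) (const_mx (makespan sigma))); last first.
  by rewrite col_mxEd mxE.
have yE i : col_mx (\col_i sigma.1 (@job_of m n s i) 0)
    (const_mx (makespan sigma) : 'cV[R]_1) (lshift 1 i) 0 = sigma.1 (job_of i) 0.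
  by rewrite col_mxEu mxE.
apply/slc_lp_feasibleE; split=> [i | l | j].
- under eq_bigr => j _ do rewrite yE.
  rewrite (sumE (fun j _ => A i j * sigma.1 j 0)) => [|j _ ->]; last by rewrite mulr0.
  by have := con i; rewrite mxE.
- under eq_bigr => j _ do rewrite yE.
  rewrite big_mkcond (sumE (fun j l' => if l' == l then sigma.1 j 0 else 0)).
    by rewrite -big_mkcond col_mxEd mxE makespan_load.
  by move=> j l' ->; rewrite if_same.
rewrite -(splitK j); case: split => a /=; first by rewrite yE.
by rewrite col_mxEd mxE makespan_ge0.
Qed.

(* A vertex of the linear program on all jobs has at most k + m nonzero
   coordinates, and t is one of them unless all processing times are 0. *)
Lemma sparse_schedule sigma : slc_feasible A b sigma.1 ->
  exists sigma' : schedule R m n,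
    [/\ slc_feasible A b sigma'.1, makespan sigma' <= makespan sigma &
        (#|[set j | (sigma'.1 j 0 != 0)%R]| <= m + k - 1)%N].
Proof.
move=> fsigma.
have [|y fy yt] := @restrict_feasible sigma (enum 'I_n) fsigma (enum_uniq _).
  by move=> j _; rewrite mem_enum.
set s := [seq _ | _ <- _] in y fy yt.
have us : uniq (unzip1 s).
  by rewrite /unzip1 -map_comp map_id_in ?enum_uniq.
have [z [fz le_z vz]] := lp_vertex (slc_lp_bounded s) fy.
have [fx le_x] := expand_feasible us fz.
exists (expand l0 (entry_of z)); split=> //.
  by apply: le_trans le_x _; rewrite -yt -!slc_lp_value.
have := vertex_support vz; set S := [set _ | _]; set S' := [set _ | _] => cardS.
have [->|[j jS']] := set_0Vmem S'; first by rewrite cards0.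
(* A job with positive time forces [t > 0], because [t] bounds the makespan and hence that time. *)
have tS : rshift (size s) 0 \in S.
  move: jS'; rewrite !inE => xj; have xj0 := fx.2 j.
  have: 0 < (expand l0 (entry_of z)).1 j 0 by rewrite lt_neqAle eq_sym xj.
  move=> xj_gt0; apply: lt0r_neq0; apply: lt_le_trans xj_gt0 _.
  apply: le_trans le_x; apply: le_trans (makespan_load _ ((expand l0 (entry_of z)).2 j)).
  by rewrite (bigD1 j) //= lerDl sumr_ge0 // => j' _; apply: fx.2.
pose T := [set i : 'I_(size s) | z (lshift 1 i) 0 != 0].
have S'T : S' \subset (@job_of m n s) @: T.
  apply/subsetP => j'; rewrite inE expand_time; apply: contraR => nT.
  apply/eqP/big1 => i /eqP ij; apply/eqP; apply: contraNT nT => zi.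
  by apply/imsetP; exists i; rewrite ?inE.
have TS : (@lshift (size s) 1) @: T \subset S :\ rshift (size s) 0.
  apply/subsetP => _ /imsetP[i iT ->]; move: iT; rewrite inE => zi.
  by rewrite !inE eq_lrshift.
(* Counting: [S'] is covered by the jobs at positions in [T], and [T] embeds in [S] without [t];
   hence at most [k + m - 1] jobs remain. *)
have := leq_trans (subset_leq_card S'T) (leq_imset_card _ _).
have := subset_leq_card TS; rewrite card_imset; last exact: lshift_inj.
have := cardsD1 (rshift (size s) 0) S; rewrite tS add1n => SE T_le S'_le.
rewrite (leq_trans S'_le) // (leq_trans T_le) // -ltnS -SE subn1.
by apply: leq_trans cardS _; rewrite addnC leqSpred.
Qed.

Definition visited : seq (passign m n) :=
  flatten [seq assignments_of J [::]
          | J <- subsets_of (minn n (m + k - 1)) (enum 'I_n) [::]].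

Lemma visited_uniq s : s \in visited -> uniq (unzip1 s).
Proof.
case/flatten_mapP => J /mem_subsets_of[t tn [_ ->]] /assignments_of_jobs ->.
rewrite !catrevE !cats0 !rev_uniq.
exact: subseq_uniq tn (enum_uniq _).
Qed.

(** A sparse schedule no worse than [sigma] uses at most [q] jobs; padding to exactly [q] gives an
    enumerated set. *)
Lemma visited_feasible sigma : slc_feasible A b sigma.1 ->
  exists2 s, s \in visited & exists2 y,
    lp_feasible (slc_lp A b s) y & y (rshift (size s) 0) 0 <= makespan sigma.
Proof.
case/sparse_schedule => sigma' [fx le_x]; set S := [set _ | _] => cardS.
set q := minn n (m + k - 1).
have Sq : (#|S| <= q)%N by have := max_card (mem S); rewrite card_ord leq_min => ->.
(* With the support listed first, the first [q] jobs contain all of it. *)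
pose J0 := take q (enum S ++ enum (~: S)).
have uJ0 : uniq J0.
  rewrite take_uniq // cat_uniq !enum_uniq andbT /=.
  by apply/hasPn => j; rewrite !mem_enum inE.
have sizeJ0 : size J0 = q.
  by rewrite size_takel // size_cat -!cardE cardsC card_ord geq_minl.
(* The same jobs in the order of [enum 'I_n], since only its sublists are enumerated. *)
pose t := [seq j <- enum 'I_n | j \in J0].
have ut : uniq t by apply/filter_uniq/enum_uniq.
have sizet : size t = q.
  rewrite -sizeJ0; apply/perm_size/uniq_perm => //.
  by move=> j; rewrite mem_filter mem_enum andbT.
(* Both loops reverse their input: [J] is what the subset loop passes on, [J'] the job order in the
   finished assignment. *)
pose J := catrev t [::].
have uJ : uniq J by rewrite /J catrevE cats0 rev_uniq.
pose J' := catrev J [::].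
have uJ' : uniq J' by rewrite /J' catrevE cats0 rev_uniq.
have [|y fy yt] := restrict_feasible fx uJ'.
  move=> j xj; rewrite /J' /J !catrevE !cats0 !mem_rev mem_filter mem_enum andbT.
  rewrite /J0 take_cat; case: ltnP => [|_]; first by rewrite -cardE ltnNge Sq.
  by rewrite mem_cat mem_enum inE xj.
exists [seq (j, sigma'.2 j) | j <- J']; last by exists y; rewrite // yt.
apply/flatten_mapP; exists J.
  apply/mem_subsets_of; exists t => //; exact: filter_subseq.
have := mem_assignments_of sigma'.2 J [::].
by rewrite /J' !catrevE !cats0 map_rev.
Qed.

Variable S : lp_solver R.
Hypothesis S_correct : lp_solver_correct S.

Let try best s := result (try_assignment A b S s best).

Lemma try_assignmentP s best :
  match try best s with
  | None => best = None /\ forall y, ~ lp_feasible (slc_lp A b s) y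
  | Some e =>
      [/\ best = Some e \/ exists2 y, lp_feasible (slc_lp A b s) y & e = entry_of y,
          forall y, lp_feasible (slc_lp A b s) y ->
             e.1 <= y (rshift (size s) 0) 0 &
          if best is Some e' then e.1 <= e'.1 else True]
  end.
Proof.
rewrite /try /try_assignment /result /=.
have := S_correct (slc_lp_bounded s); rewrite /result.
case: (S _).2 => [y [fy opt_y] | nf] /=; last first.
  by case: best => // e; split; [left | move=> y /nf | ].
have le_y z : lp_feasible (slc_lp A b s) z ->
    y (rshift (size s) 0) 0 <= z (rshift (size s) 0) 0.
  by move/opt_y; rewrite !slc_lp_value.
case: best => [e|]; last by split=> //; right; exists y.
case: leP => [ley | /ltW ley].
  by split=> //; [left | move=> z /le_y; apply: le_trans].
by split=> //; right; exists y.
Qed.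

(** Induction on the list: each iteration can only lower the recorded [t], so bounds from programs
    already tried survive. *)
Lemma best_entryP ss best :
  match foldl try best ss with
  | None => best = None /\ forall s, s \in ss -> forall y, ~ lp_feasible (slc_lp A b s) y
  | Some e =>
      [/\ best = Some e \/ exists2 s, s \in ss &
            exists2 y, lp_feasible (slc_lp A b s) y & e = entry_of y,
          forall s, s \in ss -> forall y, lp_feasible (slc_lp A b s) y ->
             e.1 <= y (rshift (size s) 0) 0 &
          if best is Some e' then e.1 <= e'.1 else True]
  end.
Proof.
elim: ss best => [|s ss IH] best /=; first by case: best => // e; split=> //; left.
have := IH (try best s); case: (foldl _ _ _) => [e [e_in le_e e_try] | [try0 nf]].
  have := try_assignmentP s best; case: (try best s) e_in e_try.
    move=> e' e_in le_e' [e'_in le_s e'_best]; split.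
    - case: e_in => [[<-] | [s' s'ss ys']]; last first.
        by right; exists s'; rewrite // inE s'ss orbT.
      by case: e'_in => [|ys]; [left | right; exists s; rewrite // inE eqxx].
    - move=> s'; rewrite inE => /orP[/eqP-> y /le_s | /le_e //].
      exact: le_trans.
    by case: (best) e'_best => // e0; apply: le_trans.
  case=> // -[s' s'ss ys'] _ [-> nf]; split=> //.
    by right; exists s'; rewrite // inE s'ss orbT.
  by move=> s''; rewrite inE => /orP[/eqP-> y /nf | /le_e].
have := try_assignmentP s best; rewrite try0 => -[-> nfs]; split=> // s'.
by rewrite inE => /orP[/eqP-> | /nf].
Qed.

Definition enumeration_loop : cost (option (record_entry R m n)) :=
  for_subsets (fun J => for_assignments (try_assignment A b S) J [::])
    (minn n (m + k - 1)) (enum 'I_n) [::] None.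

Lemma result_enumeration_loop : result enumeration_loop = foldl try None visited.
Proof.
rewrite result_for_subsets foldl_flatten foldl_map.
by apply: eq_foldl => best J; rewrite result_for_assignments.
Qed.

(** Needed for the cost of writing out the final schedule; it holds because the recorded jobs are
    distinct. *)
Lemma enumeration_loop_size e : result enumeration_loop = Some e -> (size e.2 <= n)%N.
Proof.
rewrite result_enumeration_loop => loop_e.
have := best_entryP visited None; rewrite loop_e => -[[//|[s s_in [y _ ->]]] _ _].
rewrite size_map size_enum_ord -(size_map fst).
apply: leq_trans (uniq_leq_size (visited_uniq s_in) _) (_ : (size (enum 'I_n) <= n)%N).
  by move=> j _; rewrite mem_enum.
by rewrite size_enum_ord.
Qed.

Lemma slc_enumeration_correct :
  match result (slc_enumeration A b S l0) with
  | Some sigma => slc_optimal A b sigma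
  | None => forall x, ~ slc_feasible A b x
  end.
Proof.
have -> : result (slc_enumeration A b S l0) =
    omap (expand l0) (foldl try None visited).
  rewrite -result_enumeration_loop /slc_enumeration -/enumeration_loop.
  by rewrite {1}/result /= /result; case: (enumeration_loop.2).
have := best_entryP visited None; case: (foldl _ _ _) => [e [e_in le_e _] | [_ nf]] /=.
  case: e_in => // -[s s_in [y fy eE]].
  have [fx le_x] := expand_feasible (visited_uniq s_in) fy.
  rewrite eE; split=> // sigma /visited_feasible[s' s'_in [y' fy' le_y']].
  apply: le_trans le_x _; apply: le_trans le_y'.
  by have := le_e s' s'_in y' fy'; rewrite eE.
(* Any assignment completes a feasible [x] to a schedule, so some visited program would be
   feasible. *)
move=> x fx; have [s s_in [y fy _]] := visited_feasible (sigma := (x, [ffun=> l0])) fx.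
exact: nf fy.
Qed.

End Expansion.

(** * Step counts of the loops *)

Section LoopSteps.

Lemma steps_for_each (St T : Type) (body : T -> St -> cost St) B s st :
  (forall x st, (steps (body x st) <= B)%N) ->
  (steps (for_each body s st) <= size s * B.+1)%N.
Proof.
move=> hB; elim: s st => //= x s IH st.
have := hB x st; have := IH (result (body x st)); rewrite /steps /result /=.
by rewrite mulSn; lia.
Qed.

(** Strictness lets each of the [m] recursive calls together with its tick cost at most [D]; the
    base [m.+1] restores strictness, as [m * D < m.+1 * D]. *)
Lemma steps_for_assignments (St : Type) (n m : nat)
    (body : passign m n -> St -> cost St) B J s st :
  (forall s' st, size s' = (size J + size s)%N -> (steps (body s' st) <= B)%N) ->
  (steps (for_assignments body J s st) < m.+1 ^ size J * B.+1)%N.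
Proof.
elim: J s st => [|j J IH] s st hB /=; first by rewrite expn0 mul1n ltnS hB.
set D := (m.+1 ^ size J * B.+1)%N.
have leaf l st' : (steps (for_assignments body J ((j, l) :: s) st') <= D.-1)%N.
  have := IH ((j, l) :: s) st'; rewrite -/D => h; rewrite -ltnS prednK.
    by apply: h => s' st''; rewrite /= addnS => ss; apply: hB.
  by rewrite muln_gt0 expn_gt0.
have D0 : (0 < D)%N by rewrite muln_gt0 expn_gt0.
apply: leq_ltn_trans (steps_for_each _ _ leaf) _.
by rewrite size_enum_ord prednK // expnS -mulnA -/D mulSn; lia.
Qed.

(* The strict inequality absorbs the ticks of the inner nodes of the binary
   recursion tree. *)
Lemma steps_for_subsets (St T : Type) (body : seq T -> St -> cost St) B q s J st :
  (forall J' st, size J' = (q + size J)%N -> (steps (body J' st) <= B)%N) ->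
  (steps (for_subsets body q s J st) < (size s).+1 ^ q * B.+2)%N.
Proof.
elim: s q J st => [|j s IH] [|q] J st hB /=.
- by rewrite expn0 mul1n !ltnS (leq_trans (hB _ _ _)).
- by rewrite exp1n mul1n.
- by rewrite expn0 mul1n !ltnS (leq_trans (hB _ _ _)).
rewrite /steps /=.
set st' := (for_subsets body q s (j :: J) st).2.
have h1 : (steps (for_subsets body q s (j :: J) st) < (size s).+1 ^ q * B.+2)%N.
  by apply: IH => J' st''; rewrite /= addnS => sJ; apply: hB.
have h2 := IH q.+1 J st' hB.
rewrite /steps in h1 h2.
(* With [N = size s], the two powers add up to [(N + 2) * (N + 1) ^ q], at most
   [(N + 2) ^ (q + 1)]. *)
have le_exp : ((size s).+1 ^ q * B.+2 + (size s).+1 ^ q.+1 * B.+2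
                 <= (size s).+2 ^ q.+1 * B.+2)%N.
  rewrite -mulnDl leq_mul2r /= expnS -mulSn expnS leq_mul2l /=.
  by case: q {h1 h2 hB st'} => // q; rewrite leq_exp2r.
by apply: leq_trans le_exp; lia.
Qed.

End LoopSteps.

(** * Bit length of the linear programs *)

Section Bits.

Lemma mx_bits_col_mx r1 r2 p (M : 'M_(r1, p)) (N : 'M_(r2, p)) :
  mx_bits (col_mx M N) = (mx_bits M + mx_bits N)%N.
Proof.
rewrite /mx_bits big_split_ord /=; congr addn; apply: eq_bigr => i _;
  by apply: eq_bigr => j _; rewrite ?col_mxEu ?col_mxEd.
Qed.

Lemma mx_bits_row_mx r p1 p2 (M : 'M_(r, p1)) (N : 'M_(r, p2)) :
  mx_bits (row_mx M N) = (mx_bits M + mx_bits N)%N.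
Proof.
rewrite /mx_bits -big_split; apply: eq_bigr => i _; rewrite big_split_ord /=.
by congr addn; apply: eq_bigr => j _; rewrite ?row_mxEl ?row_mxEr.
Qed.

Lemma mx_bits_le r p (M : 'M_(r, p)) d :
  (forall i j, (rat_bits (M i j) <= d)%N) -> (mx_bits M <= r * p * d)%N.
Proof.
move=> Md; rewrite -mulnA -[X in (X * _)%N]card_ord -sum_nat_const; apply: leq_sum => i _.
by rewrite -[X in (X * _)%N]card_ord -sum_nat_const; apply: leq_sum.
Qed.

Lemma rat_bits_le_mx r p (M : 'M_(r, p)) i j : (rat_bits (M i j) <= mx_bits M)%N.
Proof. by rewrite /mx_bits (bigD1 i) //= (bigD1 j) //= -!addnA leq_addr. Qed.

Lemma rat_bits_bool (u : bool) : rat_bits u%:R = 3%N.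
Proof. by case: u. Qed.

Lemma rat_bits_oppbool (u : bool) : rat_bits (- u%:R) = 3%N.
Proof. by case: u. Qed.

Lemma slc_bits_gt0 m k n (A : 'M[rat]_(k, n)) (b : 'cV[rat]_k) : (0 < slc_bits m A b)%N.
Proof. by rewrite /slc_bits /nat_bits !addSn. Qed.

(** After the dimensions, one summand per block: [k * q] entries copied from [A], and 3 bits for
    each entry 0, 1 or -1. The final 4 is 3 for the cost of [t] plus 1 for [b]. *)
Definition lp_factor (m k q : nat) : nat :=
  (nat_bits (k + m) + nat_bits (q + 1) + k * q + 3 * k + 3 * (m * q) + 6 * m
   + 3 * q + 4)%N.

Lemma slc_lp_bits m k n (A : 'M[rat]_(k, n)) (b : 'cV[rat]_k) (s : passign m n) :
  (lp_bits (slc_lp A b s) <= lp_factor m k (size s) * slc_bits m A b)%N.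
Proof.
rewrite /lp_bits /= /block_mx !mx_bits_col_mx !mx_bits_row_mx.
have zero r p : (mx_bits (0 : 'M_(r, p)) <= r * p * 3)%N.
  by apply: mx_bits_le => i j; rewrite mxE (rat_bits_bool false).
have one r p : (mx_bits (const_mx 1 : 'M[rat]_(r, p))%R <= r * p * 3)%N.
  by apply: mx_bits_le => i j; rewrite mxE (rat_bits_bool true).
have := zero k 1%N; have := zero m 1%N; have := zero (size s) 1%N.
have := one m 1%N; have := one 1%N 1%N.
set M1 := \matrix_(i, j) A i _; set M2 := \matrix_(i, j) - _.
have : (mx_bits M1 <= k * size s * mx_bits A)%N.
  by apply: mx_bits_le => i j; rewrite mxE rat_bits_le_mx.
have : (mx_bits M2 <= m * size s * 3)%N.
  by apply: mx_bits_le => i j; rewrite mxE rat_bits_oppbool.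
have : (k * size s * mx_bits A <= k * size s * slc_bits m A b)%N.
  by rewrite leq_mul2l /slc_bits; apply/orP; right; lia.
have : (mx_bits b <= slc_bits m A b)%N by rewrite /slc_bits; lia.
have := slc_bits_gt0 m A b.
move: (slc_bits _ _ _) => X X0.
have lin a : (a <= a * X)%N by rewrite leq_pmulr.
have := lin (nat_bits (k + m)); have := lin (nat_bits (size s + 1)).
have := lin (3 * k)%N; have := lin (3 * (m * size s))%N; have := lin (6 * m)%N.
have := lin (3 * size s)%N; have := lin 4%N.
rewrite /lp_factor !muln1.
move: (mx_bits M1) (mx_bits M2) (mx_bits b) (nat_bits _) (nat_bits _).
move=> a1 a2 a3 a4 a5; do 6!move: (mx_bits _) => ?.
lia.
Qed.

(** The time bound of a solver concerns images of rational programs only, so the programs it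
    receives must be of this form. *)
Lemma slc_lp_ratr (R : realFieldType) m k n (A : 'M[rat]_(k, n)) (b : 'cV[rat]_k)
    (s : passign m n) :
  slc_lp (map_mx ratr A : 'M[R]_(k, n)) (map_mx ratr b) s = lp_of_rat R (slc_lp A b s).
Proof.
rewrite /slc_lp /lp_of_rat /= map_block_mx !map_col_mx !map_const_mx !rmorph0 rmorph1.
congr LP; congr block_mx; apply/matrixP => i j; rewrite !mxE //.
by rewrite rmorphN rmorph_nat.
Qed.

End Bits.

(** The constant of a solver depends on the dimensions; only set sizes up to [m + k - 1] occur, and
    finitely many constants have a maximum. *)
Lemma uniform_bound (P : nat -> nat -> Prop) :
  (forall q c d, (c <= d)%N -> P q c -> P q d) -> (forall q, exists c, P q c) ->
  forall Q, exists c, forall q, (q <= Q)%N -> P q c.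
Proof.
move=> mono exP; elim=> [|Q [c hc]].
  by have [c hc] := exP 0%N; exists c => q; rewrite leqn0 => /eqP ->.
have [d hd] := exP Q.+1; exists (maxn c d) => q.
rewrite leq_eqVlt => /orP[/eqP -> | /hc]; first exact: mono (leq_maxr _ _) hd.
exact/mono/leq_maxl.
Qed.

(** * Running time of the algorithm *)

Section RunningTime.
Variables (R : realFieldType) (m k : nat) (S : lp_solver R).
Hypothesis S_correct : lp_solver_correct S.
Hypothesis S_linear : lp_solver_linear_time S.

Lemma steps_try_assignment Q : exists c : nat, forall q, (q <= Q)%N ->
  forall n (A : 'M[rat]_(k, n)) (b : 'cV[rat]_k) (s : passign m n) best,
  size s = q ->
  (steps (try_assignment (map_mx ratr A) (map_mx ratr b) S s best)
     <= c * slc_bits m A b)%N.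
Proof.
move: Q; apply: uniform_bound => [q c d cd hc n A b s best sq | q].
  by apply: leq_trans (hc n A b s best sq) _; rewrite leq_mul2r cd orbT.
have [c hc] := S_linear (k + m) (q + 1).
exists (c * lp_factor m k q + ((k + m) * (q + 1) + (k + m) + (q + 1) + q.+2))%N.
move=> n A b s best sq; move: hc; rewrite -{q}sq => hc.
rewrite /try_assignment slc_lp_ratr /steps /=.
have := leq_trans (hc (slc_lp A b s)) (leq_mul (leqnn c) (slc_lp_bits A b s)).
rewrite mulnA /steps => le_S; rewrite [leqRHS]mulnDl.
rewrite addnCA leq_add //; apply: leq_trans (leq_pmulr _ (slc_bits_gt0 m A b)).
by rewrite leq_add2l; case: (_.2) => [y|] //; rewrite /= addn0.
Qed.

Lemma slc_enumeration_steps : (0 < m)%N -> (0 < k)%N ->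
  exists C : nat, forall n (A : 'M[rat]_(k, n)) (b : 'cV[rat]_k) (l0 : 'I_m),
    (0 < n)%N ->
    (steps (slc_enumeration (map_mx ratr A) (map_mx ratr b) S l0)
       <= C * (n ^ (m + k - 1) * slc_bits m A b))%N.
Proof.
move=> m0 k0; set Q := (m + k - 1)%N; have Q0 : (0 < Q)%N by rewrite /Q; lia.
have [c hc] := steps_try_assignment Q.
(* [2 ^ Q] comes from [n.+1 ^ q <= 2 ^ Q * n ^ Q], [m.+1 ^ Q * c.+1] from the assignments of one
   set, the inner 2 from the bound on the subset loop, and the last 2 from the at most [n + n] steps
   of writing out the schedule. *)
exists (2 ^ Q * (m.+1 ^ Q * c.+1 + 2) + 2)%N => n A b l0 n0.
have X0 := slc_bits_gt0 m A b; set X := slc_bits m A b in X0 *.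
set q := minn n Q; have qQ : (q <= Q)%N by exact: geq_minr.
set loop := enumeration_loop m (map_mx ratr A : 'M[R]_(k, n)) (map_mx ratr b) S.
have loop_steps : (steps loop < n.+1 ^ q * (m.+1 ^ Q * (c * X).+1).+2)%N.
  rewrite -[X in (_ < X.+1 ^ _ * _)%N](size_enum_ord n).
  apply: steps_for_subsets => J st; rewrite addn0 => sizeJ.
  apply: ltnW; apply: (@leq_trans (m.+1 ^ size J * (c * X).+1)%N).
    apply: steps_for_assignments => s st'; rewrite addn0 sizeJ => sq.
    exact: (hc q).
  by rewrite leq_mul2r leq_pexp2l // sizeJ.
have end_steps : (steps (slc_enumeration (map_mx ratr A) (map_mx ratr b) S l0)
    <= steps loop + (n + n))%N.
  rewrite /slc_enumeration -/Q -/q -[for_subsets _ _ _ _ _]/loop /steps /= leq_add2l.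
  case E: loop.2 => [e|] //=; rewrite addn0 leq_add2l.
  exact: (enumeration_loop_size S_correct E).
apply: leq_trans end_steps _.
have n_exp : (n <= n ^ Q)%N by rewrite -{1}(expn1 n) leq_pexp2l.
have n1_exp : (n.+1 ^ q <= 2 ^ Q * n ^ Q)%N.
  rewrite -expnMn; apply: (@leq_trans (n.+1 ^ Q)%N); first by rewrite leq_pexp2l.
  by rewrite leq_exp2r //; lia.
rewrite mulnDl; apply: leq_add; last first.
  rewrite addnn -mul2n leq_mul2l /=; apply: leq_trans n_exp _.
  exact: leq_pmulr.
apply: leq_trans (ltnW loop_steps) _.
apply: leq_trans (leq_mul n1_exp (leqnn _)) _.
rewrite -!mulnA leq_mul2l; apply/orP; right.
rewrite mulnCA leq_mul2l; apply/orP; right.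
rewrite mulnDl -addn2 leq_add //; last by rewrite leq_pmulr.
by rewrite -mulnA leq_mul2l mulSn -[X in (X <= _)%N]add1n leq_add2r X0 orbT.
Qed.

End RunningTime.

Theorem theorem3 (m k : nat) (hm : (2 <= m)%N) (hk : (2 <= k)%N) :
  (* the enumeration algorithm, for any LP solver used as a subroutine *)
  (forall (R : realFieldType) (S : lp_solver R),
    lp_solver_correct S ->
    lp_solver_linear_time S ->
    (* it returns an optimal solution (None if there is no feasible one) *)
    (forall (n : nat) (A : 'M[R]_(k, n)) (b : 'cV[R]_k) (l0 : 'I_m),
       match result (slc_enumeration A b S l0) with
       | Some s => slc_optimal A b s
       | None => forall x : 'cV[R]_n, ~ slc_feasible A b x
       end) /\
    (* in O(n^(m+k-1) L) steps *)
    (exists C : nat,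
       forall (n : nat) (A : 'M[rat]_(k, n)) (b : 'cV[rat]_k) (l0 : 'I_m),
         (0 < n)%N ->
         (steps (slc_enumeration (map_mx ratr A : 'M[R]_(k, n))
                                 (map_mx ratr b : 'cV[R]_k) S l0)
            <= C * (n ^ (m + k - 1) * slc_bits m A b))%N)) /\
  (* and such a subroutine exists *)
  (exists T : forall r p : nat, lp_prog r p, forall R : realFieldType,
     lp_solver_correct (prog_solver T (R := R)) /\
     lp_solver_linear_time (prog_solver T (R := R))).
Proof.
split=> [R S S_correct S_linear | ]; last first.
  exists vertex_prog => R; split; last exact: vertex_prog_linear_time.
  by move=> r p P; apply: vertex_prog_correct.
split=> [n A b l0 | ]; first exact: slc_enumeration_correct.
by apply: slc_enumeration_steps => //; apply: ltnW.
Qed.
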